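(* For any integers $p,\ell$ with $1\le p\le \ell/2$, there is an instance of Budgeted Red-Blue Median that has a feasible solution which is locally optimum for the $p$-swap heuristic and whose cost is at least $\left(5+\frac{2}{p}-\frac{10p}{\ell+1}\right)\cdot OPT$, where $OPT$ is the minimum cost of a feasible solution of that instance.
   Context: Budgeted Red-Blue Median: we are given a finite set $C$ of clients, a finite set $\mathcal R$ of red facilities and a finite set $\mathcal B$ of blue facilities, all located in a metric space with distances $d(i,j)\ge 0$ (symmetric, satisfying the triangle inequality) for all $i,j\in C\cup\mathcal R\cup\mathcal B$, and integers $k_r\le|\mathcal R|$, $k_b\le|\mathcal B|$. A feasible solution is a pair $(R,B)$ with $R\subseteq\mathcal R$, $B\subseteq\mathcal B$, $|R|=k_r$, $|B|=k_b$; its cost is $\mathrm{cost}(R\cup B)=\sum_{j\in C}\min_{i\in R\cup B} d(i,j)$. A feasible solution $(R,B)$ is locally optimum for the $p$-swap heuristic if there is no feasible solution $(R',B')$ with $|R\setminus R'|\le p$, $|B\setminus B'|\le p$ and $\mathrm{cost}(R'\cup B')<\mathrm{cost}(R\cup B)$. *)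

(* Defs.v *)
From mathcomp Require Import all_boot all_order all_algebra.
From mathcomp Require Import all_classical all_reals all_analysis.

Set Implicit Arguments.
Unset Strict Implicit.
Unset Printing Implicit Defensive.

Import Order.TTheory GRing.Theory Num.Theory.

Local Open Scope ring_scope.

(* Clients and facilities are elements of a finite type [site], placed in a
   metric space by [loc]; [loc] need not be injective, so distinct sites
   (e.g. several clients) may be co-located. *)
Record instance (R : realType) := Instance {
  space : metricType R;
  site : finType;
  loc : site -> space;
  clients : {set site};
  reds : {set site};
  blues : {set site};
  reds_blues_disjoint : [disjoint reds & blues];
  kr : nat;
  kb : nat;
  kr_le : (kr <= #|reds|)%N;
  kb_le : (kb <= #|blues|)%N
}.

Section BudgetedRedBlueMedian.
Context {R : realType} (I : instance R).

Definition d (i j : site I) : R := mdist (loc i) (loc j).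

Definition solution : Type := ({set site I} * {set site I})%type.

Definition feasible (s : solution) : bool :=
  [&& s.1 \subset reds I, s.2 \subset blues I,
      #|s.1| == kr I & #|s.2| == kb I].

(* The minimum over the empty set is +oo, hence the extended-real values. *)
Definition cost (A : {set site I}) : \bar R :=
  (\sum_(j in clients I) \big[mine/+oo]_(i in A) (d i j)%:E)%E.

Definition OPT : \bar R :=
  (\big[mine/+oo]_(s : {set site I} * {set site I} | feasible s)
     cost (s.1 :|: s.2))%E.

Definition locally_optimum (p : nat) (s : solution) : Prop :=
  feasible s /\
  ~ exists s' : solution,
      [/\ feasible s', (#|s.1 :\: s'.1| <= p)%N, (#|s.2 :\: s'.2| <= p)%N &
          (cost (s'.1 :|: s'.2) < cost (s.1 :|: s.2))%E].

End BudgetedRedBlueMedian.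

(* Main.v *)
Require Import Defs.
From HB Require Import structures.
From mathcomp Require Import all_boot all_order all_algebra.
From mathcomp Require Import all_classical all_reals all_analysis.
From mathcomp Require Import zify ring lra.

(* The red swaps are made expensive by red facilities ("captors") that guard
   many blue ones.  Put q = l + 1.  The local solution consists of q p + 1 red
   captors, q red roots and one blue spoke for each pair (captor, k), k < q.
   - Every captor has q blue tips at distance 2, every root has p + 1 red tips
     at distance 2 (q - p), and each tip carries a client.
   - The remaining clients are riders, one halfway on each segment of length 2
     from a spoke to a common red center.
   The optimum opens the center and all tips and pays 1 per rider.

   Closing a spoke costs its rider 2, exactly what opening one blue tip gains.
   Opening a red tip gains 2 (q - p) but forces a captor or a root to close: a
   closed captor loses at least 2 (q - p) because at most p of its q tips can be
   opened, and a closed root loses 2 (q - p) on one of its p + 1 tips.  Opening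
   the center merely saves the at most p displaced riders, again in exchange for
   a captor or a root.  Comparing the two costs gives the ratio
   3 + 2 (p + 1) q (q - p) / (q (q p + 1)). *)

Set Implicit Arguments.
Unset Strict Implicit.
Unset Printing Implicit Defensive.

Import Order.TTheory GRing.Theory Num.Theory.

Local Open Scope ring_scope.

(** * Metric spaces with natural-number distances *)

Section NatMetric.
Variables (R : realType) (T : choiceType) (dist : T -> T -> nat).
Hypothesis dist_xx : forall x, dist x x = 0%N.
Hypothesis dist_eq0 : forall x y, dist x y = 0%N -> x = y.
Hypothesis dist_sym : forall x y, dist x y = dist y x.
Hypothesis dist_triangle : forall y x z, (dist x z <= dist x y + dist y z)%N.

Definition nat_metric : Type := T.

HB.instance Definition _ := Choice.on nat_metric.

Let mdist (x y : nat_metric) : R := (dist x y)%:R.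

Fact nat_mdistxx x : mdist x x = 0.
Proof. by rewrite /mdist dist_xx. Qed.

Fact nat_mdist_positivity x y : mdist x y = 0 -> x = y.
Proof. by move=> /eqP; rewrite pnatr_eq0 => /eqP /dist_eq0. Qed.

Fact nat_mdist_sym x y : mdist x y = mdist y x.
Proof. by rewrite /mdist dist_sym. Qed.

Fact nat_mdist_triangle y x z : mdist x z <= mdist x y + mdist y z.
Proof. by rewrite -natrD ler_nat. Qed.

HB.instance Definition _ := isMetric.Build R nat_metric
  nat_mdistxx nat_mdist_positivity nat_mdist_sym nat_mdist_triangle.

(** Packaging the structure keeps the metric axioms as explicit arguments, which could not be
    inferred from the synonym [nat_metric] alone. *)
Definition nat_metricType : metricType R := nat_metric.

Lemma nat_metricE (x y : nat_metricType) :
  @topology_theory.metric_structure.mdist R nat_metricType x y = (dist x y)%:R.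
Proof. by []. Qed.

End NatMetric.

(** * Bounds on costs and on [OPT] in the extended reals *)

Section CostBounds.
Variables (R : realType) (I : instance R).

Lemma cost_ge (X : {set site I}) (f : site I -> R) :
    (forall i j, i \in X -> j \in clients I -> f j <= d i j) ->
  ((\sum_(j in clients I) f j)%:E <= cost X)%E.
Proof.
move=> fd; rewrite /cost -sumEFin; apply: lee_sum => j jC.
apply/le_bigmin; first exact: leey.
by move=> i iX; rewrite lee_fin fd.
Qed.

Lemma cost_le (X : {set site I}) (f : site I -> R) :
    (forall j, j \in clients I -> exists2 i, i \in X & d i j <= f j) ->
  (cost X <= (\sum_(j in clients I) f j)%:E)%E.
Proof.
move=> fd; rewrite /cost -sumEFin; apply: lee_sum => j jC.
have [i iX dij] := fd j jC.
by apply: (@bigmin_inf _ _ _ _ i) => //; rewrite lee_fin.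
Qed.

Lemma OPT_le (s : solution I) :
  feasible s -> (OPT I <= cost (s.1 :|: s.2))%E.
Proof. by move=> fs; apply: (@bigmin_inf _ _ _ _ s). Qed.

(** A strict bound survives because the minimum is over finitely many solutions; finiteness of [c]
    handles the default value [+oo]. *)
Lemma OPT_gt (c : \bar R) : (c < +oo)%E ->
    (forall s : solution I, feasible s -> (c < cost (s.1 :|: s.2))%E) ->
  (c < OPT I)%E.
Proof. by move=> c_fin cs; apply/lt_bigmin. Qed.

End CostBounds.

(** * The vertices and their metric *)

Section Construction.
Variables p g : nat.

Local Notation q := (p + g.+1)%N.
Local Notation gap := (2 * g.+1)%N.
Local Notation captor_index := 'I_(q * p).+1.
Local Notation pair_index := ('I_(q * p).+1 * 'I_q)%type.
Local Notation root_index := 'I_q.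
Local Notation tip_index := ('I_q * 'I_p.+1)%type.

Inductive vertex :=
| Center
| Captor of captor_index
| Root of root_index
| RedTip of tip_index
| BlueTip of pair_index
| Spoke of pair_index
| Rider of pair_index.

Local Notation vertex_code_type :=
  (unit + captor_index + root_index + tip_index
   + pair_index + pair_index + pair_index)%type.

Definition vertex_code (x : vertex) : vertex_code_type :=
  match x with
  | Center => inl (inl (inl (inl (inl (inl tt)))))
  | Captor a => inl (inl (inl (inl (inl (inr a)))))
  | Root t => inl (inl (inl (inl (inr t))))
  | RedTip f => inl (inl (inl (inr f)))
  | BlueTip e => inl (inl (inr e))
  | Spoke e => inl (inr e)
  | Rider e => inr e
  end.

Definition vertex_decode (c : vertex_code_type) : vertex :=
  match c with
  | inl (inl (inl (inl (inl (inl _))))) => Center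
  | inl (inl (inl (inl (inl (inr a))))) => Captor a
  | inl (inl (inl (inl (inr t)))) => Root t
  | inl (inl (inl (inr f))) => RedTip f
  | inl (inl (inr e)) => BlueTip e
  | inl (inr e) => Spoke e
  | inr e => Rider e
  end.

Lemma vertex_codeK : cancel vertex_code vertex_decode.
Proof. by case. Qed.

Lemma vertex_decodeK : cancel vertex_decode vertex_code.
Proof. by do 6?[case=> //]; case. Qed.

HB.instance Definition _ := Finite.copy vertex (can_type vertex_codeK).

Lemma big_vertex (S : Type) (idx : S) (op : Monoid.com_law idx)
    (F : vertex -> S) :
  \big[op/idx]_x F x =
  op (op (op (op (op (op (F Center) (\big[op/idx]_a F (Captor a)))
                     (\big[op/idx]_t F (Root t)))
                 (\big[op/idx]_f F (RedTip f)))
             (\big[op/idx]_e F (BlueTip e)))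
         (\big[op/idx]_e F (Spoke e)))
     (\big[op/idx]_e F (Rider e)).
Proof.
rewrite (reindex vertex_decode); last first.
  apply: onW_bij; exists vertex_code; first exact: vertex_decodeK.
  exact: vertex_codeK.
by rewrite !big_sumType /= (big_pred1 tt).
Qed.

(** [None] is the star of [Center], which also contains all spokes and riders. *)
Definition cluster (x : vertex) : option (captor_index + root_index) :=
  match x with
  | Captor a => Some (inl a)
  | BlueTip e => Some (inl e.1)
  | Root t => Some (inr t)
  | RedTip f => Some (inr f.1)
  | _ => None
  end.

(** Blue tips can share labels with spokes and riders because arms are compared only within one
    cluster. A rider thus lies on the segment from its spoke to [Center]. *)
Definition arm (x : vertex) : option (pair_index + tip_index) :=
  match x with
  | BlueTip e | Spoke e | Rider e => Some (inl e)
  | RedTip f => Some (inr f)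
  | _ => None
  end.

Definition height (x : vertex) : nat :=
  match x with
  | Center | Captor _ | Root _ => 0
  | Rider _ => 1
  | BlueTip _ | Spoke _ => 2
  | RedTip _ => gap
  end.

(* Each cluster is a star whose arms meet in a point of height 0; these points
   are at pairwise distance [gap]. *)
Definition vdist (x y : vertex) : nat :=
  if cluster x != cluster y then (gap + height x + height y)%N
  else if arm x == arm y then ((height x - height y) + (height y - height x))%N
  else (height x + height y)%N.

Lemma vdist_xx x : vdist x x = 0%N.
Proof. by rewrite /vdist !eqxx /= subnn. Qed.

Lemma vdist_sym x y : vdist x y = vdist y x.
Proof.
rewrite /vdist (eq_sym (cluster y)) (eq_sym (arm y)).
by case: ifP => _; [lia|case: ifP => _; lia].
Qed.

(** Within a star this is the tree metric, for which [height] is 1-Lipschitz. Any path that leaves a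
    star passes through its hub, so a detour through another star already pays
    [height x + height z]. *)
Lemma vdist_triangle y x z : (vdist x z <= vdist x y + vdist y z)%N.
Proof.
rewrite /vdist.
have [<-|xy] := eqVneq (cluster x) (cluster y).
  have [_|_] /= := eqVneq (cluster x) (cluster z); last first.
    by case: eqP => [_|_]; lia.
  have [<-|_] := eqVneq (arm x) (arm y).
    by case: eqP => _; lia.
  have [<-|_] := eqVneq (arm y) (arm z); case: eqP => _; lia.
have [<-|yz] := eqVneq (cluster y) (cluster z).
  rewrite xy /=; case: eqP => _; lia.
by case: ifP => _ /=; [lia|case: ifP => _ /=; lia].
Qed.

(** Cluster, arm and height determine a vertex, and each cluster has a single vertex of height 0;
    distinct clusters are separated since [gap] is positive. *)
Lemma vdist_eq0 x y : vdist x y = 0%N -> x = y.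
Proof.
rewrite /vdist; have [|_] /= := eqVneq (cluster x) (cluster y); last by lia.
have [|_] /= := eqVneq (arm x) (arm y); last first.
  by case: x => [|a|t|f|e|e|e]; case: y => [|a'|t'|f'|e'|e'|e'] //=; try lia;
    move=> [->].
case: x => [|a|t|f|e|e|e]; case: y => [|a'|t'|f'|e'|e'|e'] //=;
  by [move=> [->]|move=> _ [->]].
Qed.

(** * Facilities, clients and the two competing solutions *)

Definition red_vertices : {set vertex} :=
  [set x | match x with Center | Captor _ | Root _ | RedTip _ => true
                      | _ => false end].
Definition blue_vertices : {set vertex} :=
  [set x | match x with BlueTip _ | Spoke _ => true | _ => false end].
Definition client_vertices : {set vertex} :=
  [set x | match x with RedTip _ | BlueTip _ | Rider _ => true
                      | _ => false end].
Definition red_local : {set vertex} :=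
  [set x | match x with Captor _ | Root _ => true | _ => false end].
Definition blue_local : {set vertex} :=
  [set x | match x with Spoke _ => true | _ => false end].
Definition red_global : {set vertex} :=
  [set x | match x with Center | RedTip _ => true | _ => false end].
Definition blue_global : {set vertex} :=
  [set x | match x with BlueTip _ => true | _ => false end].

Local Notation num_pairs := ((q * p).+1 * q)%N.
Local Notation num_red := ((q * p).+1 + q)%N.

Lemma card_vertex (P : pred vertex) :
  #|P| = (P Center + \sum_a P (Captor a) + \sum_t P (Root t)
          + \sum_f P (RedTip f) + \sum_e P (BlueTip e)
          + \sum_e P (Spoke e) + \sum_e P (Rider e))%N.
Proof.
transitivity (\sum_x P x)%N; last by rewrite big_vertex.
rewrite -sum1_card big_mkcond; apply: eq_bigr => x _.
by rewrite unfold_in; case: P.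
Qed.

Ltac card_vertices :=
  rewrite cardsE card_vertex /= !sum_nat_const ?card_prod !card_ord; lia.

Lemma card_red_vertices : (num_red <= #|red_vertices|)%N.
Proof. card_vertices. Qed.

Lemma card_blue_vertices : (num_pairs <= #|blue_vertices|)%N.
Proof. card_vertices. Qed.

Lemma card_red_local : #|red_local| = num_red.
Proof. card_vertices. Qed.

Lemma card_blue_local : #|blue_local| = num_pairs.
Proof. card_vertices. Qed.

Lemma card_red_global : #|red_global| = num_red.
Proof. card_vertices. Qed.

Lemma card_blue_global : #|blue_global| = num_pairs.
Proof. card_vertices. Qed.

Lemma red_blue_disjoint : [disjoint red_vertices & blue_vertices].
Proof. by apply/pred0P => -[|a|t|f|e|e|e] /=; rewrite !inE. Qed.

(* A lower bound on the distance from [j] to a set [X] of facilities. *)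
Definition service (X : {set vertex}) (j : vertex) : nat :=
  match j with
  | Rider e => if (Spoke e \in X) || (Center \in X) then 1 else 3
  | BlueTip e =>
      if BlueTip e \in X then 0 else if Captor e.1 \in X then 2 else 4
  | RedTip f =>
      if RedTip f \in X then 0 else if Root f.1 \in X then gap else 2 * gap
  | _ => 0
  end.

(** If neither a tip nor its hub is open, the closest candidates are sibling tips and hubs of other
    clusters. Siblings are at twice the height, and other hubs at [gap] plus the height, which is no
    less since every tip has height at most [gap]. Likewise a rider without its spoke and [Center]
    is at distance 3 from another spoke and at least [gap + 1] from other clusters. *)
Lemma service_le (X : {set vertex}) i j :
    X \subset red_vertices :|: blue_vertices -> i \in X ->
  (service X j <= vdist i j)%N.
Proof.
move=> /fintype.subsetP /(_ i) XF iX; move: (XF iX); rewrite !inE /vdist.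
case: j => [|a|t|f|e|e|e] //=.
- case: ifP => // /negbT fX; case: ifP => [tX|/negbT tX].
    case: i iX {XF} => [|a|t|f'|e'|e'|e'] iX //= _; try lia;
      try by case: eqP => _ /=; lia.
    case: eqP => //= _; last lia; case: eqP => [[ff]|_]; last lia.
    by rewrite -ff iX in fX.
  case: i iX {XF} => [|a|t|f'|e'|e'|e'] iX //= _; try lia.
    case: eqP => [[tf]|_]; last by rewrite /=; lia.
    by rewrite -tf iX in tX.
  case: eqP => //= _; last lia; case: eqP => [[ff]|_]; last lia.
  by rewrite -ff iX in fX.
- case: ifP => // /negbT fX; case: ifP => [tX|/negbT tX].
    case: i iX {XF} => [|a|t|f'|e'|e'|e'] iX //= _; try lia;
      try by case: eqP => _ /=; lia.
    case: eqP => //= _; last lia; case: eqP => [[ff]|_]; last lia.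
    by rewrite -ff iX in fX.
  case: i iX {XF} => [|a|t|f'|e'|e'|e'] iX //= _; try lia.
    case: eqP => [[tf]|_]; last by rewrite /=; lia.
    by rewrite -tf iX in tX.
  case: eqP => //= _; last lia; case: eqP => [[ff]|_]; last lia.
  by rewrite -ff iX in fX.
- case: ifP => [_|/negbT]; last rewrite negb_or => /andP[sX cX].
    case: i iX {XF} => [|a|t|f'|e'|e'|e'] iX //= _; try lia.
    by case: eqP => _ /=; lia.
  case: i iX {XF} => [|a|t|f'|e'|e'|e'] iX //= _; try lia.
    by rewrite iX in cX.
  by case: eqP => [[ee]|_] //=; rewrite -ee iX in sX.
Qed.

Lemma sum_service (X : {set vertex}) :
  (\sum_(j in client_vertices) service X j =
   \sum_f service X (RedTip f) + \sum_e service X (BlueTip e)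
   + \sum_e service X (Rider e))%N.
Proof.
rewrite big_mkcond big_vertex /= !inE !add0n.
under eq_bigr do rewrite inE.
rewrite big1 // add0n.
under eq_bigr do rewrite inE.
rewrite big1 // add0n.
under eq_bigr do rewrite inE.
under [X in (_ + X)%N]eq_bigr do rewrite inE.
under [X in (_ + X + _ + _)%N]eq_bigr do rewrite inE.
under [X in (_ + X + _)%N]eq_bigr do rewrite inE.
by rewrite [X in (_ + X + _)%N]big1 // addn0.
Qed.

Lemma sum_predC (J : finType) (P : pred J) :
  (\sum_i P i + \sum_i ~~ P i = #|J|)%N.
Proof.
by rewrite -big_split -sum1_card; apply: eq_bigr => i _; case: (P i).
Qed.

Lemma sum_pair (J K : finType) (F : J * K -> nat) :
  (\sum_f F f = \sum_j \sum_k F (j, k))%N.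
Proof. by rewrite pair_bigA; apply: eq_bigr => -[]. Qed.

Lemma num_pairsE : num_pairs = (\sum_(e : pair_index) 1)%N.
Proof. by rewrite sum1_card card_prod !card_ord. Qed.

(** * Accounting of gains and losses in a swap *)

Section SwapBound.
Variable X : {set vertex}.
Hypothesis blue_count :
  (\sum_e (Spoke e \in X) + \sum_e (BlueTip e \in X) = num_pairs)%N.
Hypothesis red_count :
  ((Center \in X) + \sum_a (Captor a \in X) + \sum_t (Root t \in X)
   + \sum_f (RedTip f \in X) = num_red)%N.
Hypothesis blue_swap : (\sum_e (Spoke e \notin X) <= p)%N.
Hypothesis red_swap :
  (\sum_a (Captor a \notin X) + \sum_t (Root t \notin X) <= p)%N.

Let closed_captors := (\sum_a (Captor a \notin X))%N.
Let closed_roots := (\sum_t (Root t \notin X))%N.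
Let open_red_tips := (\sum_f (RedTip f \in X))%N.
Let open_blue_tips := (\sum_e (BlueTip e \in X))%N.

Lemma blue_balance : (\sum_e (Spoke e \notin X) = open_blue_tips)%N.
Proof.
have := sum_predC (fun e => Spoke e \in X); rewrite card_prod !card_ord.
by move: blue_count; rewrite /open_blue_tips; lia.
Qed.

Lemma red_balance :
  ((Center \in X) + open_red_tips = closed_captors + closed_roots)%N.
Proof.
have := sum_predC (fun a => Captor a \in X).
have := sum_predC (fun t => Root t \in X).
rewrite !card_ord; move: red_count.
by rewrite /closed_captors /closed_roots /open_red_tips; lia.
Qed.

Lemma rider_service :
  (\sum_e service X (Rider e) =
   num_pairs + (~~ (Center \in X)) * (2 * open_blue_tips))%N.
Proof.
rewrite -blue_balance.
rewrite num_pairsE !big_distrr -big_split; apply: eq_bigr => e _ /=.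
by case: (Spoke e \in X); case: (Center \in X).
Qed.

(** Closed captors are ignored here, so an open tip is credited with a saving of only 2. *)
Lemma blue_tip_service :
  (2 * num_pairs <= \sum_e service X (BlueTip e) + 2 * open_blue_tips)%N.
Proof.
rewrite num_pairsE !big_distrr -big_split; apply: leq_sum => e _ /=.
by case: (BlueTip e \in X) => //=; case: ifP.
Qed.

(** Each of the [q] tips of a closed captor is charged 2 more, whether open or not; crediting 4 per
    open tip compensates for this. *)
Lemma blue_tip_service_closed :
  (2 * num_pairs + 2 * (closed_captors * q) <=
   \sum_e service X (BlueTip e) + 4 * open_blue_tips)%N.
Proof.
rewrite num_pairsE.
have -> : (closed_captors * q = \sum_(e : pair_index) (Captor e.1 \notin X))%N.
  rewrite sum_pair /closed_captors big_distrl; apply: eq_bigr => a _ /=.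
  by rewrite sum_nat_const card_ord mulnC.
rewrite !big_distrr -!big_split; apply: leq_sum => e _ /=.
by case: (BlueTip e \in X) => //=; case: (Captor e.1 \in X).
Qed.

(* A closed root leaves at least one of its [p.+1] tips without a facility. *)
Lemma red_tip_service :
  (gap * (q * p.+1) + gap * closed_roots <=
   \sum_f service X (RedTip f) + gap * open_red_tips)%N.
Proof.
(* Fewer red tips are open than the [p.+1] tips of a single root. *)
have open_le : (open_red_tips <= p)%N by have := red_balance; move: red_swap; lia.
have -> : (q * p.+1 = \sum_(f : tip_index) 1)%N.
  by rewrite sum1_card card_prod !card_ord.
have closed_le : (closed_roots <=
    \sum_(f : tip_index) (Root f.1 \notin X) * (RedTip f \notin X))%N.
  rewrite sum_pair /=.
  apply: leq_sum => t _; rewrite -big_distrr /=.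
  case: (Root t \notin X) => //=; rewrite mul1n lt0n.
  apply: contraTneq open_le => closed0; rewrite -ltnNge.
  have := sum_predC (fun k => RedTip (t, k) \in X).
  rewrite closed0 addn0 card_ord => <-.
  by rewrite /open_red_tips sum_pair (bigD1 t) //= leq_addr.
apply: (leq_trans (leq_add (leqnn _) (leq_mul (leqnn _) closed_le))).
rewrite /open_red_tips !big_distrr -!big_split; apply: leq_sum => f _ /=.
by case: (RedTip f \in X); case: (Root f.1 \in X); lia.
Qed.

Lemma swap_bound : (p <= g.+1)%N ->
  (3 * num_pairs + gap * (q * p.+1) <=
   \sum_(j in client_vertices) service X j)%N.
Proof.
move=> pg; rewrite sum_service rider_service.
move: blue_tip_service blue_tip_service_closed red_tip_service red_balance.
move: blue_swap; rewrite blue_balance.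
move: (\sum_e service X (BlueTip e))%N (\sum_f service X (RedTip f))%N => b r.
move: closed_captors closed_roots open_red_tips open_blue_tips => a dl rho beta.
move: num_pairs (gap * (q * p.+1))%N => N F.
(* Scaling the red balance by [g.+1] produces the same products as in the red tip bound, so linear
   arithmetic can treat them as atoms. *)
move=> beta_le hb hbc hr /(congr1 (muln g.+1)); rewrite !mulnDr => bal.
(* With no captor closed, open blue tips save at most [2 * beta]. Either the riders lose as much, or
   [Center] is open and one more root is closed than red tips are opened, which costs [gap], at
   least [2 * p]. *)
have [a0|a_gt0] := posnP a.
  by move: hb hr bal; rewrite a0; case: (Center \in X) => /=; lia.
(* Since [2 * q] is [gap + 2 * p], each closed captor pays for one red tip and leaves [2 * p]. This
   covers the net blue saving of [2 * beta]; if [Center] is open the saving is [4 * beta], and the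
   extra [gap] covers the rest. *)
have ap_ge : (p <= a * p)%N by rewrite leq_pmull.
by move: hbc hr bal; case: (Center \in X) => /=; lia.
Qed.

End SwapBound.

(** Every rider pays at least 1 in any solution, which makes [OPT] positive. *)
Lemma rider_service_ge (X : {set vertex}) :
  (num_pairs <= \sum_(j in client_vertices) service X j)%N.
Proof.
rewrite sum_service; apply: leq_trans (leq_addl _ _).
rewrite num_pairsE.
by apply: leq_sum => e _ /=; case: ifP.
Qed.

(** * The instance, its local optimum and its optimum value *)

Section Instance.
Variable R : realType.

Definition gap_instance : instance R := @Instance R
  (nat_metricType R vdist_xx vdist_eq0 vdist_sym vdist_triangle)
  vertex id client_vertices red_vertices blue_vertices red_blue_disjoint
  num_red num_pairs card_red_vertices card_blue_vertices.

Definition local_solution : solution gap_instance := (red_local, blue_local).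
Definition global_solution : solution gap_instance :=
  (red_global, blue_global).

Lemma local_feasible : feasible local_solution.
Proof.
rewrite /feasible /= card_red_local card_blue_local !eqxx !andbT.
by apply/andP; split; apply/fintype.subsetP => -[|a|t|f|e|e|e]; rewrite !inE.
Qed.

Lemma global_feasible : feasible global_solution.
Proof.
rewrite /feasible /= card_red_global card_blue_global !eqxx !andbT.
by apply/andP; split; apply/fintype.subsetP => -[|a|t|f|e|e|e]; rewrite !inE.
Qed.

Lemma cost_ge_service (s : solution gap_instance) : feasible s ->
  (((\sum_(j in client_vertices) service (s.1 :|: s.2) j)%N%:R)%:E
     <= cost (s.1 :|: s.2))%E.
Proof.
case/and4P=> sR sB _ _; rewrite natr_sum.
apply: (@cost_ge R gap_instance) => i j iX jC.
rewrite /d nat_metricE ler_nat service_le //.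
exact: finset.setUSS.
Qed.

Lemma swap_cost_ge (s : solution gap_instance) :
    (p <= g.+1)%N -> feasible s ->
    (#|red_local :\: s.1| <= p)%N -> (#|blue_local :\: s.2| <= p)%N ->
  (((3 * num_pairs + gap * (q * p.+1))%N%:R)%:E <= cost (s.1 :|: s.2))%E.
Proof.
move=> pg fs swR swB; apply: le_trans (cost_ge_service fs).
rewrite lee_fin ler_nat.
case/and4P: fs => /fintype.subsetP sR /fintype.subsetP sB /eqP cR /eqP cB.
have {}cR : #|s.1| = num_red := cR.
have {}cB : #|s.2| = num_pairs := cB.
set X := s.1 :|: s.2.
(* As the colours are disjoint, [X] determines both components of [s]. *)
have inR x : x \in red_vertices -> (x \in s.1) = (x \in X).
  rewrite finset.in_setU => xR; case: (boolP (x \in s.2)) => [/sB|]; last by rewrite orbF.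
  by rewrite (disjointFr red_blue_disjoint xR).
have inB x : x \in blue_vertices -> (x \in s.2) = (x \in X).
  rewrite finset.in_setU => xB; case: (boolP (x \in s.1)) => [/sR|] //.
  by rewrite (disjointFl red_blue_disjoint xB).
apply: swap_bound => //.
(* Writing each set as a predicate by constructor lets [card_vertex] turn its cardinality into the
   sums required by [swap_bound]. *)
- rewrite -cB (eq_card (B := fun x : vertex =>
    if x is BlueTip _ then x \in X else if x is Spoke _ then x \in X else false)).
    by rewrite card_vertex /= !sum_nat_const !muln0; lia.
  move=> x; rewrite [RHS]unfold_in; case: x => [|a|t|f|e|e|e] /=;
    by [rewrite inB ?inE|apply/negbTE/negP => /sB; rewrite inE].
- rewrite -cR (eq_card (B := fun x : vertex =>
    match x with Center | Captor _ | Root _ | RedTip _ => x \in X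
               | _ => false end)).
    by rewrite card_vertex /= !sum_nat_const !muln0 !addn0.
  move=> x; rewrite [RHS]unfold_in; case: x => [|a|t|f|e|e|e] /=;
    by [rewrite inR ?inE|apply/negbTE/negP => /sR; rewrite inE].
- move: swB; rewrite (eq_card (B := fun x : vertex =>
    if x is Spoke _ then x \notin X else false)).
    by rewrite card_vertex /= !sum_nat_const !muln0; lia.
  move=> x; rewrite [RHS]unfold_in; case: x => [|a|t|f|e|e|e] /=;
    by rewrite finset.in_setD [Y in _ && Y]inE ?andbF // andbT inB ?inE.
- move: swR; rewrite (eq_card (B := fun x : vertex =>
    match x with Captor _ | Root _ => x \notin X | _ => false end)).
    by rewrite card_vertex /= !sum_nat_const !muln0; lia.
  move=> x; rewrite [RHS]unfold_in; case: x => [|a|t|f|e|e|e] /=;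
    by rewrite finset.in_setD [Y in _ && Y]inE ?andbF // andbT inR ?inE.
Qed.

Lemma cost_le_vertex (X : {set vertex}) (f : vertex -> nat) (c : nat) :
    (forall j, j \in client_vertices -> exists2 i, i \in X & (vdist i j <= f j)%N) ->
    (\sum_(j in client_vertices) f j <= c)%N ->
  (@cost R gap_instance X <= (c%:R)%:E)%E.
Proof.
move=> fX fc; apply: (@le_trans _ _ ((\sum_(j in client_vertices) f j)%N%:R)%:E).
  rewrite natr_sum; apply: (@cost_le R gap_instance) => j /fX[i iX ij].
  by exists i; rewrite // /d nat_metricE ler_nat.
by rewrite lee_fin ler_nat.
Qed.

Lemma local_cost_le :
  (cost (local_solution.1 :|: local_solution.2)
     <= ((3 * num_pairs + gap * (q * p.+1))%N%:R)%:E)%E.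
Proof.
(* The lower bound [service] is attained here: every tip has its hub open and every rider its
   spoke. *)
apply: (@cost_le_vertex _ (service (red_local :|: blue_local))).
  move=> -[|a|t|f|e|e|e]; rewrite inE // => _.
  - by exists (Root f.1); rewrite /= ?inE // /vdist /= eqxx /=; lia.
  - by exists (Captor e.1); rewrite /= ?inE // /vdist /= eqxx /=; lia.
  - by exists (Spoke e); rewrite /= ?inE // /vdist /= eqxx.
rewrite sum_service /=.
under eq_bigr do rewrite !inE /=.
under [X in (_ + X + _)%N]eq_bigr do rewrite !inE /=.
under [X in (_ + _ + X)%N]eq_bigr do rewrite !inE /=.
by rewrite !sum_nat_const !card_prod !card_ord; lia.
Qed.

Lemma global_cost_le :
  (cost (global_solution.1 :|: global_solution.2) <= (num_pairs%:R)%:E)%E.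
Proof.
apply: (@cost_le_vertex _ (service (red_global :|: blue_global))).
  move=> -[|a|t|f|e|e|e]; rewrite inE // => _.
  - by exists (RedTip f); rewrite ?inE // vdist_xx.
  - by exists (BlueTip e); rewrite ?inE // vdist_xx.
  - by exists Center; rewrite /= ?inE ?orbT.
rewrite sum_service /=.
under eq_bigr do rewrite !inE /=.
under [X in (_ + X + _)%N]eq_bigr do rewrite !inE /=.
under [X in (_ + _ + X)%N]eq_bigr do rewrite !inE /=.
by rewrite !sum_nat_const !card_prod !card_ord; lia.
Qed.

Lemma local_solution_optimum :
  (p <= g.+1)%N -> locally_optimum p local_solution.
Proof.
move=> pg; split; first exact: local_feasible.
case=> s [fs swR swB]; rewrite ltNge => /negP; apply.
exact: le_trans local_cost_le (swap_cost_ge pg fs swR swB).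
Qed.

(** The bound for swaps is applied to the empty swap. *)
Lemma local_cost_ge : (p <= g.+1)%N ->
  (((3 * num_pairs + gap * (q * p.+1))%N%:R)%:E
     <= cost (local_solution.1 :|: local_solution.2))%E.
Proof.
by move=> pg; apply: (swap_cost_ge pg local_feasible); rewrite finset.setDv cards0.
Qed.

Lemma OPT_gap_le : (OPT gap_instance <= (num_pairs%:R)%:E)%E.
Proof. exact: le_trans (OPT_le global_feasible) global_cost_le. Qed.

Lemma OPT_gap_gt0 : (0 < OPT gap_instance)%E.
Proof.
apply: OPT_gt => [|s fs]; first exact: ltry.
apply: lt_le_trans (cost_ge_service fs).
rewrite lte_fin ltr0n; apply: leq_trans (rider_service_ge _).
by rewrite muln_gt0 /= addnS.
Qed.

End Instance.
End Construction.

(** * The arithmetic of the ratio *)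

Lemma gap_ratio (R : realType) (p g q N : nat) : (0 < p)%N ->
    q = (p + g.+1)%N -> N = ((q * p).+1 * q)%N ->
  (5 + 2 / p%:R - 10 * p%:R / q%:R) * N%:R
    <= (3 * N + 2 * g.+1 * (q * p.+1))%N%:R :> R.
Proof.
move=> p_gt0 def_q def_N.
have pR : 1 <= p%:R :> R by rewrite ler1n.
have gR : 0 <= g%:R :> R by [].
have qE : q%:R = p%:R + (g%:R + 1) :> R by rewrite def_q natrD -natr1.
have NE : N%:R = (q%:R * p%:R + 1) * q%:R :> R by rewrite def_N natrM -natr1 natrM.
rewrite natrD !natrM NE qE -(natr1 g) -(natr1 p).
move: (p%:R : R) (g%:R : R) pR gR => x y x1 y0.
have -> : (5 + 2 / x - 10 * x / (x + (y + 1))) * (((x + (y + 1)) * x + 1) * (x + (y + 1)))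
  = (5 * x + 2) * (((x + (y + 1)) * x + 1) * (x + (y + 1))) / x
    - 10 * x * ((x + (y + 1)) * x + 1).
  by field; apply/andP; split; rewrite lt0r_neq0 //; lra.
rewrite lerBlDr ler_pdivrMr; last lra.
rewrite -subr_ge0; set D := (X in 0 <= X).
(* With [x + (y + 1)] standing for [q], the terms quadratic in [q] cancel; the cubic factor is
   nonnegative because [x] is at least 1. *)
have -> : D = (x + (y + 1)) * (8 * x ^+ 3 - 2 * x ^+ 2 - 2 * x - 2) + 10 * x ^+ 2.
  by rewrite /D; ring.
have x2 : 1 <= x ^+ 2 by rewrite exprn_ege1.
have x3 : x ^+ 2 <= x ^+ 3 by rewrite [leRHS]exprS ler_peMl //; lra.
have x21 : x <= x ^+ 2 by rewrite expr2 ler_peMl //; lra.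
by apply: addr_ge0; [apply: mulr_ge0; lra|lra].
Qed.

Theorem theorem3 (R : realType) (p l : nat) (hp : (1 <= p)%N) (hpl : (2 * p <= l)%N) :
  exists (I : instance R) (s : solution I),
    [/\ locally_optimum p s,
        (0 < OPT I < +oo)%E &
        ((5 + 2 / p%:R - 10 * p%:R / l.+1%:R)%:E * OPT I
           <= cost (s.1 :|: s.2))%E].
Proof.
(* Taking [g] to be [l - p] makes [q] equal to [l.+1]. *)
have lE : l.+1 = (p + (l - p).+1)%N by lia.
have pg : (p <= (l - p).+1)%N by lia.
exists (gap_instance p (l - p) R), (local_solution p (l - p) R); split.
- exact: local_solution_optimum.
- by rewrite OPT_gap_gt0 (le_lt_trans (OPT_gap_le _ _ _)) // ltry.
apply: le_trans (local_cost_ge _ pg).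
apply: le_trans (lee_wpmul2l _ (OPT_gap_le _ _ _)) _.
  (* Replacing [OPT] by its upper bound needs a nonnegative factor: [2 * p <= l] makes the
     subtracted term at most 5. *)
  have pR : 1 <= p%:R :> R by rewrite ler1n.
  have plR : 2 * p%:R <= l%:R :> R by rewrite -natrM ler_nat.
  rewrite lee_fin subr_ge0 ler_pdivrMr ?ltr0n // -(natr1 l).
  apply: (@le_trans _ _ (5 * (l%:R + 1))); first by lra.
  by apply: ler_wpM2r; [lra|rewrite lerDl divr_ge0 //; lra].
by rewrite -EFinM lee_fin lE; apply: gap_ratio.
Qed.
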